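(* For integers $A,B\ge0$ put $J_{A,B}(t)=\sum_{k\ge0}\binom{A}{k}\binom{B}{k}t^k$. Fix an integer $\kappa\ge0$ and put $$\Delta_t(z)=\sqrt{\bigl(1+(1-t)z\bigr)^2-4z},$$ with the square-root branch $\Delta_t(0)=1$. Then $$\sum_{n\ge0}J_{n,n+\kappa}(t)z^n=\frac{1}{\Delta_t(z)}\left(\frac{1+(1-t)z-\Delta_t(z)}{2z}\right)^{\!\kappa}$$ as an identity of formal power series in $z$ with coefficients in $\mathbb{Q}[t]$; the quotient inside the power has a removable singularity at $z=0$ and constant term $1$. In particular, for every real $t\ge0$ and every fixed integer $\kappa\ge0$, $$\lim_{n\to\infty}J_{n,n+\kappa}(t)^{1/n}=(1+\sqrt t)^2.$$ *)

(* Defs.v *)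
From HB Require Import structures.
From mathcomp Require Import all_boot all_order all_algebra.
From mathcomp Require Import all_classical all_reals all_analysis.
Set Implicit Arguments.
Unset Strict Implicit.
Unset Printing Implicit Defensive.
Import GRing.Theory.
Local Open Scope ring_scope.

(* A fresh record rather than [nat -> R]: plain functions already carry the
   pointwise product, whereas power series are multiplied by convolution. *)
Record fps (R : Type) := FPS { fpscoef : nat -> R }.
Coercion fpscoef : fps >-> Funclass.

HB.instance Definition _ (R : Type) := [isNew for @fpscoef R].
HB.instance Definition _ (R : choiceType) := [Choice of fps R by <:].

Lemma fpsP (R : Type) (f g : fps R) : f =1 g -> f = g.
Proof. by case: f g => [f] [g] /= /funext ->. Qed.

(* Sequence defined by course-of-values recursion: [step] receives the list of
   all previous values. *)
Fixpoint covprefix (R : Type) (step : seq R -> R) (n : nat) : seq R :=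
  if n is m.+1 then rcons (covprefix step m) (step (covprefix step m)) else [::].

Definition covrec (R : Type) (step : seq R -> R) (n : nat) : R :=
  step (covprefix step n).

Lemma size_covprefix (R : Type) (step : seq R -> R) n :
  size (covprefix step n) = n.
Proof. by elim: n => //= n IHn; rewrite size_rcons IHn. Qed.

Lemma nth_covprefix (R : Type) (x0 : R) (step : seq R -> R) n i :
  (i < n)%N -> nth x0 (covprefix step n) i = covrec step i.
Proof.
elim: n => //= n IHn; rewrite ltnS leq_eqVlt nth_rcons size_covprefix.
by case: ltngtP => //= [/IHn|->].
Qed.

Section Zmodule.
Variable R : zmodType.
Implicit Types f g h : fps R.

Definition fps0 : fps R := FPS (fun=> 0).
Definition fpsopp f : fps R := FPS (fun n => - f n).
Definition fpsadd f g : fps R := FPS (fun n => f n + g n).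

Fact fpsaddA : associative fpsadd.
Proof. by move=> f g h; apply: fpsP => n /=; rewrite addrA. Qed.
Fact fpsaddC : commutative fpsadd.
Proof. by move=> f g; apply: fpsP => n /=; rewrite addrC. Qed.
Fact fpsadd0 : left_id fps0 fpsadd.
Proof. by move=> f; apply: fpsP => n /=; rewrite add0r. Qed.
Fact fpsaddN : left_inverse fps0 fpsopp fpsadd.
Proof. by move=> f; apply: fpsP => n /=; rewrite addNr. Qed.

HB.instance Definition _ :=
  GRing.isZmodule.Build (fps R) fpsaddA fpsaddC fpsadd0 fpsaddN.

Lemma fpscoef0 n : (0 : fps R) n = 0. Proof. by []. Qed.
Lemma fpscoefD f g n : (f + g) n = f n + g n. Proof. by []. Qed.
Lemma fpscoefN f n : (- f) n = - f n. Proof. by []. Qed.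

End Zmodule.

Section Ring.
Variable R : comNzRingType.
Implicit Types f g h : fps R.

Definition fpsC (c : R) : fps R := FPS (fun n => if n == 0 then c else 0).
Definition fpsX : fps R := FPS (fun n => (n == 1)%:R).
Definition fpsmul f g : fps R := FPS (fun n => \sum_(i < n.+1) f i * g (n - i)%N).

Let trunc n f : {poly R} := \poly_(i < n.+1) f i.

Let fpsmul_trunc n f g k :
  (k <= n)%N -> fpsmul f g k = (trunc n f * trunc n g)`_k.
Proof.
move=> kn; rewrite coefM /=; apply: eq_bigr => i _.
have ik : (i <= k)%N by rewrite -ltnS.
by rewrite !coef_poly !ltnS (leq_trans ik kn) (leq_trans (leq_subr _ _) kn).
Qed.

Fact fpsmulC : commutative fpsmul.
Proof.
by move=> f g; apply: fpsP => n; rewrite !(@fpsmul_trunc n) // mulrC.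
Qed.

Fact fpsmulA : associative fpsmul.
Proof.
suff H f g h n : fpsmul (fpsmul f g) h n
    = (trunc n f * trunc n g * trunc n h)`_n.
  move=> f g h; apply: fpsP => n.
  by rewrite fpsmulC !H mulrC mulrA.
rewrite coefM /=; apply: eq_bigr => i _; congr (_ * _).
  by rewrite -fpsmul_trunc // -ltnS.
by rewrite coef_poly ltnS leq_subr.
Qed.

Fact fpsmul1 : left_id (fpsC 1) fpsmul.
Proof.
move=> f; apply: fpsP => n /=; rewrite big_ord_recl /= mul1r subn0.
by rewrite big1 ?addr0 // => i _; rewrite mul0r.
Qed.

Fact fpsmulDl : left_distributive fpsmul (@fpsadd R).
Proof.
move=> f g h; apply: fpsP => n /=; rewrite -big_split /=.
by apply: eq_bigr => i _; rewrite mulrDl.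
Qed.

Fact fps1_neq0 : fpsC 1 != 0.
Proof.
apply/eqP => /(congr1 (fun f : fps R => f 0)) /= /eqP.
by rewrite oner_eq0.
Qed.

HB.instance Definition _ := GRing.Zmodule_isComNzRing.Build (fps R)
  fpsmulA fpsmulC fpsmul1 fpsmulDl fps1_neq0.

Lemma fpscoef1 n : (1 : fps R) n = (n == 0)%:R.
Proof. by rewrite [LHS]/=; case: eqP. Qed.

Lemma fpscoefM f g n : (f * g) n = \sum_(i < n.+1) f i * g (n - i)%N.
Proof. by []. Qed.

Lemma fpscoef0M f g : (f * g) 0 = f 0 * g 0.
Proof. by rewrite fpscoefM big_ord1. Qed.

(* The quotient of a power series with zero constant term by the variable. *)
Definition fpsdivX f : fps R := FPS (fun n => f n.+1).

Lemma fpsXM f n : (fpsX * f) n = if n is m.+1 then f m else 0.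
Proof.
rewrite fpscoefM big_ord_recl /= mul0r add0r; case: n => [|n].
  by rewrite big_ord0.
rewrite big_ord_recl /= mul1r subSS subn0 big1 ?addr0 // => i _.
by rewrite mul0r.
Qed.

Lemma fpsdivXK f : f 0 = 0 -> fpsX * fpsdivX f = f.
Proof. by move=> f0; apply: fpsP => -[|n]; rewrite fpsXM. Qed.

End Ring.

Arguments fpsX {R}.

Section UnitRing.
Variable R : comUnitRingType.
Implicit Types f g h : fps R.

Definition fpsunit : {pred fps R} := fun f => f 0 \is a GRing.unit.

(* Solves [\sum_(i <= m) g i * f (m - i) = (m == 0)] for [g m]. *)
Definition fpsinv f : fps R :=
  if f \in fpsunit then
    FPS (covrec (fun s : seq R =>
      (f 0)^-1 * ((size s == 0)%:R
                  - \sum_(0 <= i < size s) s`_i * f (size s - i)%N)))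
  else f.

Fact fpsmulV : {in fpsunit, left_inverse 1 fpsinv *%R}.
Proof.
move=> f fu; apply: fpsP => n; rewrite fpscoefM /fpsinv fu.
rewrite big_ord_recr /= subnn {2}/covrec size_covprefix mulrAC mulVr // mul1r.
rewrite big_mkord.
under [X in _ - X]eq_bigr => i _ do rewrite nth_covprefix //.
by rewrite addrC subrK; case: (n == 0).
Qed.

Fact fpsunitPl f g : g * f = 1 -> fpsunit f.
Proof.
move=> /(congr1 (fun h : fps R => h 0)); rewrite fpscoef0M fpscoef1 => gf1.
by apply/unitrPr; exists (g 0); rewrite mulrC.
Qed.

Fact fpsinv_out : {in [predC fpsunit], fpsinv =1 id}.
Proof. by move=> f; rewrite /fpsinv inE /= => /negbTE ->. Qed.

HB.instance Definition _ := GRing.ComNzRing_hasMulInverse.Build (fps R)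
  fpsmulV fpsunitPl fpsinv_out.

Lemma fpsunitE f : (f \is a GRing.unit) = (f 0 \is a GRing.unit).
Proof. by []. Qed.

(* The square root with constant term 1 of a power series with constant term 1,
   over a ring in which 2 is invertible: the recursion solves
   [\sum_(i <= m) d i * d (m - i) = f m] for [d m]. *)
Definition fpssqrt f : fps R :=
  FPS (covrec (fun s : seq R =>
    if size s == 0 then 1
    else 2%:R^-1 * (f (size s)
                    - \sum_(1 <= i < size s) s`_i * s`_(size s - i)))).

Lemma fpssqrt0 f : fpssqrt f 0 = 1. Proof. by []. Qed.

Lemma fpssqrtS f n : fpssqrt f n.+1 =
  2%:R^-1 * (f n.+1 - \sum_(i < n) fpssqrt f i.+1 * fpssqrt f (n - i)%N).
Proof.
rewrite [LHS]/fpscoef [LHS]/= [LHS]/covrec; set step := (X in covprefix X).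
have := size_covprefix step n.+1.
have := @nth_covprefix _ 0 step n.+1.
move: (covprefix step n.+1) => s sE ->; rewrite big_add1 big_mkord.
congr (_ * (_ - _)); apply: eq_bigr => i _.
by rewrite subSS !sE ?ltnS ?leq_subr.
Qed.

Lemma sqr_fpssqrt f :
  (2%:R : R) \is a GRing.unit -> f 0 = 1 -> fpssqrt f ^+ 2 = f.
Proof.
move=> u2 f0; apply: fpsP => -[|n].
  by rewrite expr2 fpscoef0M !fpssqrt0 mulr1 f0.
rewrite expr2 fpscoefM big_ord_recl big_ord_recr subn0 subnn.
rewrite !fpssqrt0 mul1r mulr1 !lift0.
rewrite fpssqrtS; set S := \sum_(i < n) _; set T := (X in _ + (X + _)).
have -> : T = S by apply: eq_bigr => i _.
rewrite addrCA; set h := _^-1 * _.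
by rewrite -mulr2n -[h *+ 2]mulr_natl mulVKr // addrC subrK.
Qed.

Lemma fpssqrt_unique f g :
  (2%:R : R) \is a GRing.unit -> f 0 = 1 -> g ^+ 2 = f -> g 0 = 1 ->
  g = fpssqrt f.
Proof.
move=> u2 f0 gf g0; apply/eqP; rewrite -subr_eq0.
have U : g + fpssqrt f \is a GRing.unit.
  by rewrite fpsunitE fpscoefD g0 fpssqrt0.
by rewrite -(mulIr_eq0 _ (mulIr U)) -subr_sqr gf sqr_fpssqrt // subrr.
Qed.

End UnitRing.

Definition J (A B : nat) : {poly rat} :=
  \poly_(k < A.+1) ('C(A, k) * 'C(B, k))%:R.

(* Beyond degree A the coefficients vanish, so J is the sum over all k. *)
Lemma coef_J A B k : (J A B)`_k = ('C(A, k) * 'C(B, k))%:R.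
Proof. by rewrite coef_poly; case: ltnP => // Ak; rewrite bin_small. Qed.

(* In {poly rat} the variable 'X is t; in fps {poly rat}, fpsX is z. *)
Definition linear_tz : fps {poly rat} := 1 + fpsC (1 - 'X) * fpsX.

Definition Delta : fps {poly rat} := fpssqrt (linear_tz ^+ 2 - 4%:R * fpsX).

Definition quot_tz : fps {poly rat} :=
  2%:R^-1 * fpsdivX (linear_tz - Delta).

Lemma unit2_polyrat : (2%:R : {poly rat}) \is a GRing.unit.
Proof. by rewrite -polyC_natr poly_unitE size_polyC coefC. Qed.

Lemma linear_tz0 : linear_tz 0 = 1.
Proof. by rewrite fpscoefD fpscoef0M /= mulr0 addr0. Qed.

Lemma radicand0 : (linear_tz ^+ 2 - 4%:R * fpsX) 0 = 1.
Proof.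
by rewrite expr2 fpscoefD fpscoefN !fpscoef0M linear_tz0 /= !mulr0 subr0 mulr1.
Qed.

Lemma sqr_Delta : Delta ^+ 2 = linear_tz ^+ 2 - 4%:R * fpsX.
Proof. exact: sqr_fpssqrt unit2_polyrat radicand0. Qed.

Lemma Delta0 : Delta 0 = 1. Proof. exact: fpssqrt0. Qed.

Lemma Delta_unit : Delta \is a GRing.unit.
Proof. by rewrite fpsunitE Delta0 unitr1. Qed.

(* Main.v *)
(* Pascal's rule J_{A+1,B+1} + (1-t) J_{A,B} = J_{A,B+1} + J_{A+1,B} makes the
   generating functions F_k = \sum_n J_{n,n+k} z^n satisfy
   L F_{k+1} = z F_{k+2} + F_k with L = 1 + (1-t)z, while Q = (L - Delta)/(2z)
   satisfies z Q^2 = L Q - 1.  Hence D_k = F_{k+1} - Q F_k obeys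
   D_k = z Q D_{k+1}, so every D_k is divisible by all powers of z and vanishes:
   F_k = Q^k F_0.  The symmetry of J gives L F_0 = 2z F_1 + 1, that is,
   Delta F_0 = 1.
   For the growth rate put s = \sqrt t; the binomial theorem and
   Cauchy-Schwarz give
   (1+s)^{2n} / (n+1) <= J_{n,n+k}(t) <= (1+s)^{2n+k}. *)
Require Import Defs.
From mathcomp Require Import all_boot all_order all_algebra.
From mathcomp Require Import all_classical all_reals all_analysis.
From mathcomp Require Import ring.
Import Order.TTheory GRing.Theory Num.Theory numFieldNormedType.Exports.
Local Open Scope classical_set_scope.
Local Open Scope ring_scope.

(** * Power series over a commutative ring *)

Lemma fpsCM (R : comNzRingType) (c : R) (f : fps R) n :
  (fpsC c * f) n = c * f n.
Proof.
rewrite fpscoefM big_ord_recl /= subn0 big1 ?addr0 // => i _.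
by rewrite mul0r.
Qed.

Lemma fpsX_inj (R : comNzRingType) : injective ( *%R (@fpsX R)).
Proof.
move=> f g fg; apply: fpsP => n.
by have := congr1 (fun h : fps R => h n.+1) fg; rewrite !fpsXM.
Qed.

(** Coefficient [n.+1] of [D k] involves only coefficients of [D k.+1] of index at most [n], so
    strong induction on the index works for all [k] at once. *)
Lemma fpsX_div_eq0 (R : comNzRingType) (q : fps R) (D : nat -> fps R) :
  (forall k, D k = fpsX * (q * D k.+1)) -> forall k, D k = 0.
Proof.
move=> DE k; apply: fpsP => n.
elim/ltn_ind: n k => -[|n] IHn k; rewrite DE fpsXM fpscoef0 //.
by rewrite fpscoefM big1 // => i _; rewrite IHn ?mulr0 // ltnS leq_subr.
Qed.

(** * Recurrences and closed form of the generating functions *)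

Lemma linear_tzM f n : (linear_tz * f) n =
  f n + (1 - 'X) * (if n is m.+1 then f m else 0).
Proof. by rewrite mulrDl mul1r -mulrA fpscoefD fpsCM fpsXM. Qed.

Lemma J_sym A B : J A B = J B A.
Proof. by apply/polyP => k; rewrite !coef_J mulnC. Qed.

Lemma J_pascal A B :
  J A.+1 B.+1 + (1 - 'X) * J A B = J A B.+1 + J A.+1 B.
Proof.
apply/polyP => k; rewrite mulrBl mul1r !coefD coefN coefXM !coef_J.
case: k => [|k] /=; first by rewrite !bin0 subr0.
by rewrite !binS !natrM !natrD; ring.
Qed.

Lemma J0n B : J 0 B = 1.
Proof. by apply/polyP => -[|k]; rewrite coef_J coef1 ?bin0. Qed.

Definition Jgf k : fps {poly rat} := FPS (fun n => J n (n + k)).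

Lemma Jgf_rec k : linear_tz * Jgf k.+1 = fpsX * Jgf k.+2 + Jgf k.
Proof.
apply: fpsP => n; rewrite linear_tzM fpscoefD fpsXM; case: n => [|n] /=.
  by rewrite mulr0 addr0 add0r !J0n.
by rewrite !addnS !addSn -J_pascal.
Qed.

(** On the diagonal, Pascal's rule also produces [J n.+1 n]; symmetry turns it into [J n n.+1],
    whence the factor 2. *)
Lemma Jgf_rec0 : linear_tz * Jgf 0 = 2%:R * (fpsX * Jgf 1) + 1.
Proof.
apply: fpsP => n; rewrite mulr_natl mulr2n linear_tzM !fpscoefD fpsXM fpscoef1.
case: n => [|n] /=.
  by rewrite mulr0 addr0 !add0r J0n.
by rewrite !addn0 addn1 addr0 J_pascal; congr (_ + _); exact: J_sym.
Qed.

Lemma unit2_fps : (2%:R : fps {poly rat}) \is a GRing.unit.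
Proof. exact: unit2_polyrat. Qed.

Lemma quot_tzE : 2%:R * fpsX * quot_tz = linear_tz - Delta.
Proof.
rewrite /quot_tz mulrAC (mulVKr unit2_fps) mulrC fpsdivXK //.
by rewrite fpscoefD fpscoefN linear_tz0 Delta0 subrr.
Qed.

Lemma quot_tz_quadratic : fpsX * quot_tz ^+ 2 = linear_tz * quot_tz - 1.
Proof.
(* After multiplication by [4 * fpsX] the claim is [sqr_Delta] with [Delta] expressed through
   [quot_tz]. *)
apply: (@fpsX_inj {poly rat}); do 2!apply: (mulrI unit2_fps).
have := sqr_Delta.
have -> : Delta = linear_tz - 2%:R * fpsX * quot_tz by rewrite quot_tzE; ring.
move=> /eqP; rewrite -subr_eq0 => /eqP sqrE.
by apply/eqP; rewrite -subr_eq0 -sqrE; apply/eqP; ring.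
Qed.

Lemma quot_tz0 : quot_tz 0%N = 1.
Proof.
have /(congr1 (fun f : fps {poly rat} => f 0)) := quot_tz_quadratic.
rewrite fpsXM fpscoefD fpscoefN fpscoef0M linear_tz0 mul1r fpscoef1.
by move/eqP; rewrite eq_sym subr_eq0 => /eqP.
Qed.

Lemma JgfS k : Jgf k.+1 = quot_tz * Jgf k.
Proof.
apply/eqP; rewrite -subr_eq0; apply/eqP; move: k.
apply: (fpsX_div_eq0 _ quot_tz) => k.
(* With [Jgf k] eliminated, the terms in [Jgf k.+2] agree and those in [Jgf k.+1] match by
   [quot_tz_quadratic]. *)
have -> : Jgf k = linear_tz * Jgf k.+1 - fpsX * Jgf k.+2.
  by rewrite Jgf_rec; ring.
have -> : fpsX * (quot_tz * (Jgf k.+2 - quot_tz * Jgf k.+1)) =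
    quot_tz * (fpsX * Jgf k.+2) - fpsX * quot_tz ^+ 2 * Jgf k.+1 by ring.
rewrite quot_tz_quadratic; ring.
Qed.

Lemma Jgf_quot k : Jgf k = Delta^-1 * quot_tz ^+ k.
Proof.
elim: k => [|k IHk]; last by rewrite JgfS IHk exprS mulrCA.
rewrite expr0 -[LHS](mulKr Delta_unit); congr (_ * _).
(* Since [quot_tz * Jgf 0 = Jgf 1], the subtracted term cancels the one in [Jgf_rec0]. *)
have -> : Delta = linear_tz - 2%:R * fpsX * quot_tz by rewrite quot_tzE; ring.
rewrite mulrBl Jgf_rec0 JgfS; ring.
Qed.

(** * Bounds and growth rate *)

Lemma sum_bin_expr (R : pzSemiRingType) (x : R) n :
  \sum_(k < n.+1) 'C(n, k)%:R * x ^+ k = (1 + x) ^+ n.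
Proof.
rewrite addrC exprD1n; apply: eq_bigr => k _.
by rewrite mulr_natl.
Qed.

(** Splitting [s ^+ (2 * k)] evenly gives an inner product of the terms of two binomial expansions,
    the form both bounds use. *)
Lemma horner_J (R : realType) (s : R) A B :
  (map_poly ratr (J A B)).[s ^+ 2] =
  \sum_(k < A.+1) ('C(A, k)%:R * s ^+ k) * ('C(B, k)%:R * s ^+ k).
Proof.
rewrite (@horner_coef_wide _ A.+1) ?size_map_poly ?size_poly //.
apply: eq_bigr => k _; rewrite coef_map coef_J /= rmorph_nat natrM -exprM.
by rewrite mulnC exprM; ring.
Qed.

Lemma sqr_sum_le (R : realFieldType) n (a : 'I_n -> R) :
  (\sum_i a i) ^+ 2 <= n%:R * \sum_i a i ^+ 2.
Proof.
case: n a => [|n] a; first by rewrite !big_ord0 expr0n mulr0.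
set S := \sum_i a i; have n0 : 0 < n.+1%:R :> R by rewrite ltr0n.
(* Deviations from the mean, scaled to avoid division. *)
have : 0 <= \sum_i (n.+1%:R * a i - S) ^+ 2.
  by apply: sumr_ge0 => i _; exact: sqr_ge0.
have -> : \sum_i (n.+1%:R * a i - S) ^+ 2 =
    n.+1%:R * (n.+1%:R * (\sum_i a i ^+ 2) - S ^+ 2).
  under eq_bigr => i _ do rewrite sqrrB exprMn.
  rewrite big_split sumrB /= sumr_const card_ord sumrMnl -!mulr_sumr.
  rewrite -mulr_suml -mulr_sumr -/S. ring.
by rewrite pmulr_rge0 // subr_ge0.
Qed.

Section growth.
Variables (R : realType) (s : R).
Hypothesis s0 : 0 <= s.

Let bin_ge0 n k : 0 <= 'C(n, k)%:R * s ^+ k.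
Proof. by rewrite mulr_ge0 ?exprn_ge0. Qed.

Lemma J_le A B : (map_poly ratr (J A B)).[s ^+ 2] <= (1 + s) ^+ (A + B).
Proof.
rewrite horner_J exprD -[_ ^+ A]sum_bin_expr mulr_suml.
apply: ler_sum => k _; apply: ler_wpM2l; first exact: bin_ge0.
(* The second factor is zero or a single term of the nonnegative expansion of [(1 + s) ^+ B]. *)
have [Bk|kB] := ltnP B k.
  by rewrite bin_small // mul0r exprn_ge0 // addr_ge0.
rewrite -sum_bin_expr (bigD1 (inord k : 'I_B.+1)) //= inordK // lerDl.
by apply: sumr_ge0.
Qed.

(** After Cauchy-Schwarz, ['C(n, i) <= 'C(n + k, i)] bounds each square by a term of [J]. *)
Lemma J_ge n k :
  (1 + s) ^+ n ^+ 2 <= n.+1%:R * (map_poly ratr (J n (n + k))).[s ^+ 2].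
Proof.
rewrite -sum_bin_expr (le_trans (sqr_sum_le _ _ _)) //.
rewrite ler_wpM2l // horner_J; apply: ler_sum => i _.
rewrite expr2 ler_wpM2l // ler_wpM2r ?exprn_ge0 // ler_nat.
by rewrite leq_bin2l // leq_addr.
Qed.

Lemma J_root_cvg k :
  ((map_poly ratr (J n (n + k))).[s ^+ 2] `^ (n%:R^-1))
     @[n --> \oo] --> (1 + s) ^+ 2.
Proof.
have s1 : 0 < 1 + s by rewrite ltr_pwDl.
pose u n := (map_poly ratr (J n (n + k))).[s ^+ 2].
have u0 n : 0 < u n.
  rewrite -(pmulr_rgt0 _ (ltr0Sn R n)); apply: lt_le_trans (J_ge n k).
  by rewrite !exprn_gt0.
pose l := ln (1 + s).
have lE m : (1 + s) ^+ m = expR (m%:R * l).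
  by rewrite expRM_natl lnK ?posrE.
have -> : (fun n => (map_poly ratr (J n (n + k))).[s ^+ 2] `^ n%:R^-1) =
          (fun n => expR (n%:R^-1 * ln (u n))).
  by apply/funext => n; rewrite -/(u n) /powR gt_eqF.
have inv0 : (n%:R^-1 : R) @[n --> \oo] --> 0.
  by rewrite -cvg_shiftS; exact: cvg_harmonic.
rewrite lE; apply: continuous_cvg; first exact: continuous_expR.
(* [J_ge] would give the error [ln (n + 1) / n]; the cruder [sqrt (2 / n)] has an immediate
   limit. *)
apply: (@squeeze_cvgr _ _ _ _ (fun n => 2 * l - Num.sqrt (2 * n%:R^-1))
                 (fun n => 2 * l + n%:R^-1 * (k%:R * l))).
- near=> n; have n0 : (0 < n%:R :> R).
    by rewrite ltr0n; near: n; exact: nbhs_infty_gt.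
  apply/andP; split.
    rewrite [leRHS]mulrC ler_pdivlMr // -ler_expR lnK ?posrE //.
    set w := Num.sqrt _.
    (* [(w * n)^2 / 2 = n], hence the choice of [w] *)
    have nw : n.+1%:R <= expR (w * n%:R).
      have wn0 : 0 <= w * n%:R by rewrite mulr_ge0 ?sqrtr_ge0.
      apply: le_trans (expR_ge1Dxn 1 wn0).
      rewrite exprMn sqr_sqrtr ?mulr_ge0 ?invr_ge0 // -natr1 addrC lerD2l.
      have -> // : 2 * n%:R^-1 * n%:R ^+ 2 / 2`!%:R = n%:R :> R.
      by rewrite (_ : 2`! = 2)%N //; field; rewrite gt_eqF.
    have := J_ge n k; rewrite -exprM lE -/(u n) => un.
    have -> : (2 * l - w) * n%:R = (n * 2)%:R * l - w * n%:R.
      by rewrite natrM; ring.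
    rewrite expRD expRN ler_pdivrMr ?expR_gt0 // [leRHS]mulrC.
    by apply: (le_trans un); rewrite ler_wpM2r // ltW.
  rewrite [leLHS]mulrC ler_pdivrMr // -ler_expR lnK ?posrE //.
  apply: (le_trans (J_le n (n + k))); rewrite lE ler_expR !natrD.
  have -> : (2 * l + n%:R^-1 * (k%:R * l)) * n%:R = (n%:R + (n%:R + k%:R)) * l.
    by field; rewrite gt_eqF.
  by [].
- rewrite -[X in _ --> X]subr0; apply: cvgB; first exact: cvg_cst.
  rewrite -(@sqrtr0 R) -(mulr0 (2:R)).
  apply: continuous_cvg; first exact: sqrt_continuous.
  by apply: cvgM; first exact: cvg_cst.
- rewrite -[X in _ --> X]addr0; apply: cvgD; first exact: cvg_cst.
  rewrite -(mul0r (k%:R * l)); apply: cvgM => //; exact: cvg_cst.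
Unshelve. all: by end_near. Qed.

End growth.

Theorem proposition4p10 (kappa : nat) :
  [/\ 2%:R * fpsX * quot_tz = linear_tz - Delta,
      quot_tz 0%N = 1,
      FPS (fun n : nat => J n (n + kappa)) = Delta^-1 * quot_tz ^+ kappa
    & forall (R : realType) (t : R), 0 <= t ->
        ((map_poly ratr (J n (n + kappa))).[t] `^ (n%:R^-1))
          @[n --> \oo] --> (1 + Num.sqrt t) ^+ 2].
Proof.
split=> [| | |R t t0]; [exact: quot_tzE | exact: quot_tz0 | exact: Jgf_quot |].
rewrite -{1}[t]sqr_sqrtr //; exact: J_root_cvg (sqrtr_ge0 t) kappa.
Qed.
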